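(* Let $s$ be an integer and $\alpha=(1+\sqrt5)/2$. Then \[ \sum_{j = 1}^\infty \frac{F_{2j + s}}{j\binom{2j}j} = (F_{s + 1} \sqrt 5 - F_{s - 1} )\frac{\pi }{5}\sqrt {\frac{\alpha ^3 }{\sqrt 5 }}, \qquad \sum_{j = 1}^\infty \frac{L_{2j + s}}{j\binom{2j}j} = (L_{s + 1} \sqrt 5 - L_{s - 1} )\frac{\pi }{5}\sqrt {\frac{\alpha ^3 }{\sqrt 5 }}. \]
   Context: $F_j$ and $L_j$ denote the Fibonacci and Lucas numbers, defined for all integers $j$ by $F_0=0$, $F_1=1$, $L_0=2$, $L_1=1$, $F_j=F_{j-1}+F_{j-2}$, $L_j=L_{j-1}+L_{j-2}$, extended to negative indices by $F_{-j}=(-1)^{j-1}F_j$, $L_{-j}=(-1)^jL_j$; equivalently $F_j=(\alpha^j-\beta^j)/\sqrt5$, $L_j=\alpha^j+\beta^j$ with $\alpha=(1+\sqrt5)/2$, $\beta=(1-\sqrt5)/2$. *)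

(* Defs.v *)
From Stdlib Require Import Reals ZArith.
From Coquelicot Require Import Coquelicot.

Fixpoint fib_nat (n : nat) : Z :=
  match n with
  | O => 0
  | S p => match p with O => 1 | S q => fib_nat p + fib_nat q end
  end%Z.

Fixpoint lucas_nat (n : nat) : Z :=
  match n with
  | O => 2
  | S p => match p with O => 1 | S q => lucas_nat p + lucas_nat q end
  end%Z.

Definition fib (j : Z) : Z :=
  match j with
  | Z0 => fib_nat 0
  | Zpos p => fib_nat (Pos.to_nat p)
  | Zneg p => (-1) ^ (Zpos p - 1) * fib_nat (Pos.to_nat p)
  end%Z.

Definition lucas (j : Z) : Z :=
  match j with
  | Z0 => lucas_nat 0
  | Zpos p => lucas_nat (Pos.to_nat p)
  | Zneg p => (-1) ^ (Zpos p) * lucas_nat (Pos.to_nat p)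
  end%Z.

Definition golden : R := ((1 + sqrt 5) / 2)%R.

(* [C] alone would be Coquelicot's type of complex numbers. *)
Definition central_binom (j : nat) : R := Binomial.C (2 * j) j.

(* Coquelicot's [is_series] starts at 0: this says that the series
   a 1 + a 2 + a 3 + ... converges with sum l. *)
Definition is_series_from1 (a : nat -> R) (l : R) : Prop :=
  is_series (fun n => a (S n)) l.

(* Main.v *)
Require Import Defs.
From Stdlib Require Import Reals ZArith Lra Lia.
From Coquelicot Require Import Coquelicot.
Open Scope R_scope.

(** By Binet's formula both series are combinations of
    [S y = sum_(j >= 1) (4 y)^j / (j * binom (2 j) j)] at [4 y = alpha^2] and
    [4 y = beta^2]. Writing [S y = 2 y P y], the coefficients of the power
    series [P] satisfy a two-term recurrence, equivalent to
    [(1 - 2 y) P + 2 y (1 - y) P' = 1]. This equation says that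
    [sin t * cos t * P (sin t ^ 2)] has derivative [1], so it equals [t], and
    [S (sin t ^ 2) = 2 t tan t]. Finally [alpha / 2 = sin (3 pi / 10)] and
    [- beta / 2 = sin (pi / 10)]. *)

(** * Central binomial coefficients and the coefficients of [P] *)

Lemma central_binom_pos (n : nat) : 0 < central_binom n.
Proof.
  unfold central_binom, Binomial.C.
  apply Rdiv_lt_0_compat; [apply INR_fact_lt_0|].
  apply Rmult_lt_0_compat; apply INR_fact_lt_0.
Qed.

Lemma central_binom_0 : central_binom 0 = 1.
Proof. unfold central_binom, Binomial.C; simpl; field. Qed.

Lemma central_binom_S (n : nat) :
  (INR n + 1) * central_binom (S n) = 2 * (2 * INR n + 1) * central_binom n.
Proof.
  unfold central_binom, Binomial.C.
  replace (2 * S n - S n)%nat with (S n) by lia.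
  replace (2 * n - n)%nat with n by lia.
  replace (2 * S n)%nat with (S (S (2 * n))) by lia.
  rewrite !fact_simpl, !mult_INR, !S_INR, mult_INR.
  change (INR 2) with 2.
  pose proof (pos_INR n). pose proof (INR_fact_lt_0 n).
  field; lra.
Qed.

(** The coefficient of [y ^ n] in [P], that is, half the coefficient of [y ^ S n] in [S y]. The
    shift avoids the undefined term at [j = 0]. *)
Definition tan_coef (n : nat) : R :=
  4 ^ S n / (2 * (INR (S n) * central_binom (S n))).

Lemma tan_coef_0 : tan_coef 0 = 1.
Proof.
  unfold tan_coef.
  pose proof (central_binom_S 0) as H.
  rewrite central_binom_0 in H. simpl in *.
  replace (central_binom 1) with 2 by lra. field.
Qed.

Lemma tan_coef_S (n : nat) :
  (2 * INR n + 3) * tan_coef (S n) = 2 * (INR n + 1) * tan_coef n.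
Proof.
  unfold tan_coef.
  pose proof (central_binom_S (S n)) as H.
  pose proof (central_binom_pos (S n)) as Hp.
  pose proof (pos_INR n) as Hn.
  rewrite !S_INR in *.
  replace (central_binom (S (S n))) with
    (2 * (2 * (INR n + 1) + 1) * central_binom (S n) / (INR n + 1 + 1))
    by (rewrite <- H; field; lra).
  simpl. field. lra.
Qed.

(** By the recurrence, consecutive coefficients have ratio [2 (n + 1) / (2 n + 3) < 1], starting
    from 1. *)
Lemma tan_coef_bound (n : nat) : 0 <= tan_coef n <= 1.
Proof.
  induction n as [|n IH].
  - rewrite tan_coef_0; lra.
  - pose proof (tan_coef_S n). pose proof (pos_INR n). nra.
Qed.

(** * The power series and its differential equation *)

Lemma tan_coef_CV_radius (y : R) :
  Rabs y < 1 -> Rbar_lt (Rabs y) (CV_radius tan_coef).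
Proof.
  intros Hy.
  apply Rbar_lt_le_trans with 1; [exact Hy|].
  apply (proj1 (CV_radius_bounded tan_coef) 1).
  exists 1; intros n.
  rewrite pow1, Rmult_1_r.
  pose proof (tan_coef_bound n).
  rewrite Rabs_pos_eq; lra.
Qed.

(** With [c] for [tan_coef], the coefficient of [y ^ n] on the left is [(2 n + 1) c_n - 2 n c_(n-1)]
    for [n >= 1], which vanishes by the recurrence; only [c_0 = 1] remains. *)
Lemma tan_coef_ode (y : R) : Rabs y < 1 ->
  (1 - 2 * y) * PSeries tan_coef y
  + 2 * y * (1 - y) * PSeries (PS_derive tan_coef) y = 1.
Proof.
  intros Hy.
  pose proof (tan_coef_CV_radius y Hy) as Hr.
  assert (H0 : ex_pseries tan_coef y)
    by (apply CV_radius_inside; exact Hr).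
  assert (H1 : ex_pseries (PS_derive tan_coef) y)
    by (apply CV_radius_inside; rewrite CV_radius_derive; exact Hr).
  apply PSeries_correct in H0. apply PSeries_correct in H1.
  set (P := PSeries tan_coef y) in *.
  set (D := PSeries (PS_derive tan_coef) y) in *.
  (* The series of [y P], [y P'] and [y ^ 2 P'], which are then scaled and added to that of [P]. *)
  pose proof (is_pseries_incr_1 _ _ _ H0) as H2.
  pose proof (is_pseries_incr_1 _ _ _ H1) as H3.
  pose proof (is_pseries_incr_1 _ _ _ H3) as H4.
  pose proof (is_pseries_scal (-2) _ _ _ (Rmult_comm _ _) H2) as H5.
  pose proof (is_pseries_scal 2 _ _ _ (Rmult_comm _ _) H3) as H6.
  pose proof (is_pseries_scal (-2) _ _ _ (Rmult_comm _ _) H4) as H7.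
  pose proof (is_pseries_plus _ _ _ _ _ H0
    (is_pseries_plus _ _ _ _ _ H5 (is_pseries_plus _ _ _ _ _ H6 H7))) as H8.
  pose proof (is_pseries_unique _ _ _ H8) as HS.
  rewrite PSeries_decr_1 in HS by (eexists; exact H8).
  rewrite (PSeries_ext _ (fun _ => 0)), PSeries_const_0 in HS.
  - unfold PS_plus, PS_scal, PS_incr_1, plus, scal, zero in HS; simpl in HS.
    unfold mult in HS; simpl in HS. rewrite tan_coef_0 in HS. lra.
  - intros n; pose proof (tan_coef_S n) as HR.
    unfold PS_decr_1, PS_plus, PS_scal, PS_incr_1, PS_derive, plus, scal, zero;
      simpl; unfold mult; simpl.
    (* The doubly shifted series of [y ^ 2 P'] still has coefficient 0 at [y ^ 1], hence the case
       split. *)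
    destruct n as [|n]; simpl in *; lra.
Qed.

(** * Closed form of the series at [sin t ^ 2] *)

Lemma sin2_lt_1 (t : R) : 0 < cos t -> Rabs (sin t ^ 2) < 1.
Proof.
  intros Hc. pose proof (sin2_cos2 t). unfold Rsqr in *.
  rewrite Rabs_pos_eq; nra.
Qed.

Lemma PSeries_tan_coef_sin2 (t : R) : 0 < t < PI / 2 ->
  sin t * cos t * PSeries tan_coef (sin t ^ 2) = t.
Proof.
  intros Ht.
  set (K := fun u => sin u * cos u * PSeries tan_coef (sin u ^ 2)).
  assert (HK : forall u, 0 <= u <= t -> is_derive K u 1).
  { intros u Hu.
    assert (Hc : 0 < cos u) by (apply cos_gt_0; lra).
    pose proof (sin2_lt_1 u Hc) as Hy.
    pose proof (tan_coef_ode _ Hy) as Hode.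
    pose proof (is_derive_PSeries _ _ (tan_coef_CV_radius _ Hy)) as HP.
    assert (HQ : is_derive (fun u => PSeries tan_coef (sin u ^ 2)) u
              ((2 * sin u * cos u) * PSeries (PS_derive tan_coef) (sin u ^ 2))).
    { apply (is_derive_comp (PSeries tan_coef) (fun u => sin u ^ 2)).
      - exact HP.
      - auto_derive; [exact I|ring]. }
    assert (HT : is_derive (fun u => sin u * cos u) u
                  (cos u ^ 2 - sin u ^ 2)).
    { auto_derive; [exact I|ring]. }
    pose proof (is_derive_mult _ _ _ _ _ HT HQ Rmult_comm) as HM.
    replace 1 with ((cos u ^ 2 - sin u ^ 2) * PSeries tan_coef (sin u ^ 2)
      + sin u * cos u
        * (2 * sin u * cos u * PSeries (PS_derive tan_coef) (sin u ^ 2)));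
      [exact HM|].
    (* The differential equation at [y = sin u ^ 2], where [1 - y] is [cos u ^ 2] and [1 - 2 y] is
       [cos u ^ 2 - sin u ^ 2]. *)
    rewrite <- Hode.
    pose proof (sin2_cos2 u) as E; unfold Rsqr in E.
    replace (1 - sin u ^ 2) with (cos u ^ 2) by (simpl; lra).
    replace (1 - 2 * sin u ^ 2) with (cos u ^ 2 - sin u ^ 2) by (simpl; lra).
    ring. }
  (* As the derivative is constantly 1, the mean value theorem gives [K t - K 0 = t], and [K 0 = 0]
     because [sin 0 = 0]. *)
  destruct (MVT_gen K 0 t (fun _ => 1)) as [c [_ Hc]].
  - intros x Hx. rewrite Rmin_left, Rmax_right in Hx by lra. apply HK; lra.
  - intros x Hx. rewrite Rmin_left, Rmax_right in Hx by lra.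
    apply continuity_pt_filterlim.
    apply (ex_derive_continuous K). exists 1. apply HK; lra.
  - unfold K in Hc at 2. rewrite sin_0 in Hc. unfold K in Hc. lra.
Qed.

Lemma is_series_central_binom_sin (x t : R) :
  0 < t < PI / 2 -> x = 4 * sin t ^ 2 ->
  is_series_from1 (fun j => x ^ j / (INR j * central_binom j))
    (2 * t * tan t).
Proof.
  intros Ht ->.
  assert (Hc : 0 < cos t) by (apply cos_gt_0; lra).
  assert (Hs : 0 < sin t) by (apply sin_gt_0; lra).
  pose proof (sin2_lt_1 t Hc) as Hy.
  pose proof (PSeries_tan_coef_sin2 t Ht) as HP.
  pose proof (PSeries_correct _ _
    (CV_radius_inside _ _ (tan_coef_CV_radius _ Hy))) as H.
  apply is_pseries_R in H.
  (* The factor [2 y] turns [P y] back into [S y]. *)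
  apply (is_series_scal_l (2 * sin t ^ 2)) in H.
  unfold is_series_from1.
  replace (2 * t * tan t) with (2 * sin t ^ 2 * PSeries tan_coef (sin t ^ 2)).
  - assert (E : forall n : nat,
      2 * sin t ^ 2 * (tan_coef n * (sin t ^ 2) ^ n)
      = (4 * sin t ^ 2) ^ S n / (INR (S n) * central_binom (S n))).
    { intros n; unfold tan_coef.
      pose proof (central_binom_pos (S n)).
      pose proof (lt_0_INR (S n) ltac:(lia)).
      rewrite Rpow_mult_distr.
      change ((sin t ^ 2) ^ S n) with (sin t ^ 2 * (sin t ^ 2) ^ n).
      field. lra. }
    exact (is_series_ext _ _ _ E H).
  - transitivity (2 * tan t * (sin t * cos t * PSeries tan_coef (sin t ^ 2))).
    + unfold tan. field. lra.
    + rewrite HP. ring.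
Qed.

(** * Sines and tangents of [PI / 10] and [3 * PI / 10] *)

Definition golden_conj : R := (1 - sqrt 5) / 2.

Lemma sqrt5_sqr : sqrt 5 * sqrt 5 = 5.
Proof. apply sqrt_sqrt; lra. Qed.

Lemma sqrt5_bounds : 2 < sqrt 5 < 3.
Proof. pose proof sqrt5_sqr. pose proof (sqrt_pos 5). nra. Qed.

Lemma sin_PI10 : sin (PI / 10) = - golden_conj / 2.
Proof.
  pose proof sqrt5_sqr. pose proof sqrt5_bounds. pose proof PI_RGT_0.
  set (x := PI / 10).
  assert (Hs : 0 < sin x) by (apply sin_gt_0; unfold x; lra).
  assert (Hs1 : sin x < 1).
  { rewrite <- sin_PI2. apply sin_increasing_1; unfold x; lra. }
  (* [3 x] and [2 x] are complementary angles. *)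
  assert (E : sin (3 * x) = cos (2 * x)).
  { rewrite <- sin_shift. f_equal. unfold x. field. }
  replace (3 * x) with (2 * x + x) in E by ring.
  rewrite sin_plus, sin_2a, cos_2a_sin in E.
  assert (E2 : cos x * cos x = 1 - sin x * sin x)
    by (pose proof (sin2_cos2 x) as F; unfold Rsqr in F; lra).
  replace (2 * sin x * cos x * cos x) with (2 * sin x * (cos x * cos x)) in E by ring.
  rewrite E2 in E.
  (* The triple and double angle formulas give a cubic in [sin x] with the root 1, excluded by
     [sin x < 1]. *)
  assert (Q : (sin x - 1) * (4 * sin x * sin x + 2 * sin x - 1) = 0) by lra.
  apply Rmult_integral in Q. destruct Q as [Q|Q]; [lra|].
  unfold golden_conj.
  (* Of the two roots of the quadratic factor, only one is positive. *)
  assert (Q2 : (sin x - (sqrt 5 - 1) / 4) * (sin x + (sqrt 5 + 1) / 4) = 0) by nra.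
  apply Rmult_integral in Q2. destruct Q2; lra.
Qed.

Lemma sin_3PI10 : sin (3 * PI / 10) = golden / 2.
Proof.
  pose proof sqrt5_sqr.
  replace (3 * PI / 10) with (PI / 2 - 2 * (PI / 10)) by field.
  rewrite sin_shift, cos_2a_sin, sin_PI10.
  unfold golden, golden_conj. nra.
Qed.

Lemma tan_sqr_sin (t : R) : 0 < cos t ->
  tan t * tan t * (1 - sin t * sin t) = sin t * sin t.
Proof.
  intros Hc.
  replace (1 - sin t * sin t) with (cos t * cos t)
    by (pose proof (sin2_cos2 t) as F; unfold Rsqr in F; lra).
  unfold tan. field. lra.
Qed.

(** Since [golden ^ 2 = golden + 1], the squared tangent [golden ^ 2 / (4 - golden ^ 2)] is
    [golden ^ 2 / (3 - golden)], and [sqrt 5 = golden (3 - golden)]. *)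
Lemma tan_3PI10 : tan (3 * PI / 10) = sqrt (golden ^ 3 / sqrt 5).
Proof.
  pose proof sqrt5_sqr. pose proof sqrt5_bounds. pose proof PI_RGT_0.
  symmetry. apply sqrt_lem_1.
  - apply Rlt_le, Rdiv_lt_0_compat; [apply pow_lt; unfold golden|]; lra.
  - apply Rlt_le, tan_gt_0; lra.
  - pose proof (tan_sqr_sin (3 * PI / 10) ltac:(apply cos_gt_0; lra)) as E.
    rewrite sin_3PI10 in E.
    assert (G : golden * golden = golden + 1) by (unfold golden; nra).
    assert (G5 : sqrt 5 = 2 * golden - 1) by (unfold golden; lra).
    assert (1 < golden) by (unfold golden; lra).
    set (T := tan _ * tan _) in *.
    apply (Rmult_eq_reg_r (sqrt 5)); [|lra].
    replace (golden ^ 3 / sqrt 5 * sqrt 5) with (golden ^ 3) by (field; lra).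
    rewrite G5.
    assert (E1 : T * (3 - golden) = golden + 1) by nra.
    replace (2 * golden - 1) with (golden * (3 - golden)) by nra.
    replace (T * (golden * (3 - golden))) with (golden * (T * (3 - golden))) by ring.
    rewrite E1. simpl. nra.
Qed.

Lemma tan_PI10 : tan (PI / 10) = (sqrt 5 - 2) * sqrt (golden ^ 3 / sqrt 5).
Proof.
  rewrite <- tan_3PI10.
  pose proof sqrt5_sqr. pose proof sqrt5_bounds. pose proof PI_RGT_0.
  assert (T1 : 0 < tan (PI / 10)) by (apply tan_gt_0; lra).
  assert (T3 : 0 < tan (3 * PI / 10)) by (apply tan_gt_0; lra).
  pose proof (tan_sqr_sin (PI / 10) ltac:(apply cos_gt_0; lra)) as E1.
  pose proof (tan_sqr_sin (3 * PI / 10) ltac:(apply cos_gt_0; lra)) as E3.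
  rewrite sin_PI10 in E1. rewrite sin_3PI10 in E3.
  unfold golden, golden_conj in *.
  set (a := tan (PI / 10)) in *. set (b := tan (3 * PI / 10)) in *.
  (* Both sides are nonnegative, so it suffices to compare squares, which are rational in
     [r = sqrt 5]. *)
  apply Rsqr_inj; [lra|nra|]. unfold Rsqr.
  set (r := sqrt 5) in *.
  assert (A : a * a = (3 - r) / (5 + r)).
  { apply (Rmult_eq_reg_r (5 + r)); [|lra].
    unfold Rdiv; rewrite Rmult_assoc, (Rmult_assoc (3 - r)), Rinv_l by lra. nra. }
  assert (B : b * b = (3 + r) / (5 - r)).
  { apply (Rmult_eq_reg_r (5 - r)); [|lra].
    unfold Rdiv; rewrite (Rmult_assoc (3 + r)), Rinv_l by lra. nra. }
  replace ((r - 2) * b * ((r - 2) * b)) with ((r - 2) * (r - 2) * (b * b)) by ring.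
  rewrite A, B.
  apply (Rmult_eq_reg_r ((5 + r) * (5 - r))); [|nra].
  replace ((3 - r) / (5 + r) * ((5 + r) * (5 - r))) with ((3 - r) * (5 - r)) by (field; lra).
  replace ((r - 2) * (r - 2) * ((3 + r) / (5 - r)) * ((5 + r) * (5 - r)))
    with ((r - 2) * (r - 2) * ((3 + r) * (5 + r))) by (field; lra).
  replace ((r - 2) * (r - 2)) with (9 - 4 * r) by lra.
  replace ((3 + r) * (5 + r)) with (20 + 8 * r) by lra.
  lra.
Qed.

(** * Binet's formulas at all integer indices *)

Lemma golden_mul_conj : golden * golden_conj = -1.
Proof. pose proof sqrt5_sqr. unfold golden, golden_conj. lra. Qed.

Lemma fib_nat_binet (n : nat) :
  IZR (fib_nat n) = (golden ^ n - golden_conj ^ n) / sqrt 5.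
Proof.
  pose proof sqrt5_sqr. pose proof sqrt5_bounds.
  (* The recurrence reaches back two indices, so the induction carries two consecutive values. *)
  enough (H2 : IZR (fib_nat n) = (golden ^ n - golden_conj ^ n) / sqrt 5 /\
    IZR (fib_nat (S n)) = (golden ^ S n - golden_conj ^ S n) / sqrt 5) by apply H2.
  induction n as [|n [I1 I2]].
  - split; simpl; unfold golden, golden_conj; field; lra.
  - split; [exact I2|].
    change (fib_nat (S (S n))) with (fib_nat (S n) + fib_nat n)%Z.
    rewrite plus_IZR, I1, I2.
    assert (G : golden * golden = golden + 1) by (unfold golden; lra).
    assert (G' : golden_conj * golden_conj = golden_conj + 1)
      by (unfold golden_conj; lra).
    replace (golden ^ S (S n)) with (golden * golden * golden ^ n) by (simpl; ring).
    replace (golden_conj ^ S (S n))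
      with (golden_conj * golden_conj * golden_conj ^ n) by (simpl; ring).
    rewrite G, G'. simpl. field. lra.
Qed.

Lemma lucas_nat_binet (n : nat) :
  IZR (lucas_nat n) = golden ^ n + golden_conj ^ n.
Proof.
  pose proof sqrt5_sqr.
  enough (H2 : IZR (lucas_nat n) = golden ^ n + golden_conj ^ n /\
    IZR (lucas_nat (S n)) = golden ^ S n + golden_conj ^ S n) by apply H2.
  induction n as [|n [I1 I2]].
  - split; simpl; unfold golden, golden_conj; lra.
  - split; [exact I2|].
    change (lucas_nat (S (S n))) with (lucas_nat (S n) + lucas_nat n)%Z.
    rewrite plus_IZR, I1, I2.
    assert (G : golden * golden = golden + 1) by (unfold golden; lra).
    assert (G' : golden_conj * golden_conj = golden_conj + 1)
      by (unfold golden_conj; lra).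
    replace (golden ^ S (S n)) with (golden * golden * golden ^ n) by (simpl; ring).
    replace (golden_conj ^ S (S n))
      with (golden_conj * golden_conj * golden_conj ^ n) by (simpl; ring).
    rewrite G, G'. simpl. ring.
Qed.

(** From [golden * golden_conj = -1]: negative powers of one root are signed positive powers of the
    other, which matches the sign rule at negative indices. *)
Lemma inv_golden_pow (n : nat) : / golden ^ n = (-1) ^ n * golden_conj ^ n.
Proof.
  rewrite <- Rpow_mult_distr, <- pow_inv. f_equal.
  pose proof golden_mul_conj. pose proof sqrt5_bounds.
  assert (golden <> 0) by (unfold golden; lra).
  apply (Rmult_eq_reg_l golden); [|assumption].
  rewrite Rinv_r by assumption. lra.
Qed.

Lemma inv_golden_conj_pow (n : nat) : / golden_conj ^ n = (-1) ^ n * golden ^ n.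
Proof.
  rewrite <- Rpow_mult_distr, <- pow_inv. f_equal.
  pose proof golden_mul_conj. pose proof sqrt5_bounds.
  assert (golden_conj <> 0) by (unfold golden_conj; lra).
  apply (Rmult_eq_reg_l golden_conj); [|assumption].
  rewrite Rinv_r by assumption. lra.
Qed.

Lemma fib_binet (j : Z) :
  IZR (fib j) = (powerRZ golden j - powerRZ golden_conj j) / sqrt 5.
Proof.
  pose proof sqrt5_bounds.
  destruct j as [|p|p]; cbn [fib powerRZ].
  - simpl; field; lra.
  - apply fib_nat_binet.
  - rewrite mult_IZR, fib_nat_binet, inv_golden_pow, inv_golden_conj_pow.
    (* Writing [p = k + 1] makes the sign exponent [p - 1] the natural number [k]; exchanging the
       two roots accounts for the remaining sign. *)
    destruct (Pos2Nat.is_succ p) as [k Hk].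
    replace (Zpos p - 1)%Z with (Z.of_nat k) by lia.
    rewrite <- pow_IZR, Hk. simpl ((-1) ^ S k). field; lra.
Qed.

Lemma lucas_binet (j : Z) :
  IZR (lucas j) = powerRZ golden j + powerRZ golden_conj j.
Proof.
  destruct j as [|p|p]; cbn [lucas powerRZ].
  - simpl; lra.
  - apply lucas_nat_binet.
  - rewrite mult_IZR, lucas_nat_binet, inv_golden_pow, inv_golden_conj_pow.
    rewrite <- positive_nat_Z, <- pow_IZR. ring.
Qed.

(** * Combination of the series for the two roots *)

Lemma is_series_lin_comb (u v : R) (a b c : nat -> R) (la lb l : R) :
  is_series a la -> is_series b lb ->
  (forall n, u * a n + v * b n = c n) -> u * la + v * lb = l ->
  is_series c l.
Proof.
  intros Ha Hb Hc <-.
  exact (is_series_ext _ _ _ Hc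
    (is_series_plus _ _ _ _ (is_series_scal_l u _ _ Ha) (is_series_scal_l v _ _ Hb))).
Qed.

(** The shift [s] contributes a factor [x ^ s] independent of [j]; as [s] may be negative, this is
    an integer power of a nonzero [x]. *)
Lemma is_series_powerRZ (x l : R) (s : Z) : x <> 0 ->
  is_series_from1 (fun j => (x ^ 2) ^ j / (INR j * central_binom j)) l ->
  is_series_from1
    (fun j => powerRZ x (2 * Z.of_nat j + s) / (INR j * central_binom j))
    (powerRZ x s * l).
Proof.
  intros Hx H. unfold is_series_from1 in *.
  assert (E : forall n : nat,
    powerRZ x s * ((x ^ 2) ^ S n / (INR (S n) * central_binom (S n)))
    = powerRZ x (2 * Z.of_nat (S n) + s) / (INR (S n) * central_binom (S n))).
  { intros n.
    replace (2 * Z.of_nat (S n))%Z with (Z.of_nat (2 * S n)) by lia.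
    rewrite powerRZ_add, <- pow_powerRZ, pow_mult by assumption.
    unfold Rdiv. ring. }
  exact (is_series_ext _ _ _ E (is_series_scal_l (powerRZ x s) _ _ H)).
Qed.

Theorem theorem5 (s : Z) :
  is_series_from1
    (fun j => IZR (fib (2 * Z.of_nat j + s)) / (INR j * central_binom j))
    ((IZR (fib (s + 1)) * sqrt 5 - IZR (fib (s - 1)))
       * (PI / 5) * sqrt (golden ^ 3 / sqrt 5))
  /\
  is_series_from1
    (fun j => IZR (lucas (2 * Z.of_nat j + s)) / (INR j * central_binom j))
    ((IZR (lucas (s + 1)) * sqrt 5 - IZR (lucas (s - 1)))
       * (PI / 5) * sqrt (golden ^ 3 / sqrt 5)).
Proof.
  pose proof sqrt5_sqr. pose proof sqrt5_bounds. pose proof PI_RGT_0.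
  assert (Ha : golden <> 0) by (unfold golden; lra).
  assert (Hb : golden_conj <> 0) by (unfold golden_conj; lra).
  pose proof (is_series_powerRZ _ _ s Ha
    (is_series_central_binom_sin (golden ^ 2) (3 * PI / 10)
    ltac:(lra) ltac:(rewrite sin_3PI10; field))) as HA.
  pose proof (is_series_powerRZ _ _ s Hb
    (is_series_central_binom_sin (golden_conj ^ 2) (PI / 10)
    ltac:(lra) ltac:(rewrite sin_PI10; field))) as HB.
  rewrite tan_3PI10 in HA. rewrite tan_PI10 in HB.
  set (c := sqrt (golden ^ 3 / sqrt 5)) in *.
  assert (Va : / golden = - golden_conj)
    by (pose proof (inv_golden_pow 1) as E; simpl in E; rewrite !Rmult_1_r in E; lra).
  assert (Vb : / golden_conj = - golden)
    by (pose proof (inv_golden_conj_pow 1) as E; simpl in E; rewrite !Rmult_1_r in E; lra).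
  (* The sums in [HA] and [HB] are [3] and [sqrt 5 - 2] times the [s]-th power of the root, in units
     of [PI / 5 * c]. Here and in [Eb] these factors are matched with the shifted indices [s + 1]
     and [s - 1]. *)
  assert (Ea : powerRZ golden (s + 1) * sqrt 5 - powerRZ golden (s - 1)
               = 3 * powerRZ golden s).
  { unfold Z.sub. rewrite !powerRZ_add by assumption. simpl.
    rewrite Rmult_1_r, Va.
    replace 3 with (golden * sqrt 5 + golden_conj)
      by (unfold golden, golden_conj; lra).
    ring. }
  assert (Eb : powerRZ golden_conj (s + 1) * sqrt 5 - powerRZ golden_conj (s - 1)
               = (sqrt 5 - 2) * powerRZ golden_conj s).
  { unfold Z.sub. rewrite !powerRZ_add by assumption. simpl.
    rewrite Rmult_1_r, Vb.
    replace (sqrt 5 - 2) with (golden_conj * sqrt 5 + golden)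
      by (unfold golden, golden_conj; lra).
    ring. }
  unfold is_series_from1 in *.
  split.
  - apply (is_series_lin_comb (/ sqrt 5) (- / sqrt 5) _ _ _ _ _ _ HA HB).
    + intros n. rewrite fib_binet. unfold Rdiv. ring.
    + rewrite !fib_binet.
      (* The factor [PI / 5] arises from [2 * (3 * PI / 10) = 3 * (PI / 5)] and
         [2 * (PI / 10) = PI / 5]. *)
      transitivity (/ sqrt 5 * (3 * powerRZ golden s
        - (sqrt 5 - 2) * powerRZ golden_conj s) * (PI / 5) * c); [field; lra|].
      rewrite <- Ea, <- Eb. field; lra.
  - apply (is_series_lin_comb 1 1 _ _ _ _ _ _ HA HB).
    + intros n. rewrite lucas_binet. unfold Rdiv. ring.
    + rewrite !lucas_binet.
      transitivity ((3 * powerRZ golden s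
        + (sqrt 5 - 2) * powerRZ golden_conj s) * (PI / 5) * c); [field|].
      rewrite <- Ea, <- Eb. field.
Qed.
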